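(* Let $\boldsymbol{\mu}_+,\boldsymbol{\mu}_-\in\mathbb{R}^d$, $\sigma>0$, and let $(\boldsymbol{X},Y)$ be random with $P(Y=+)=P(Y=-)=1/2$ and $\boldsymbol{X}\mid Y=i\sim N(\boldsymbol{\mu}_i,\sigma^2\boldsymbol{I}_d)$ for $i\in\{+,-\}$. Let $\boldsymbol{w}\in\mathbb{R}^d\setminus\{\boldsymbol{0}\}$, $b\in\mathbb{R}$ and let the linear classifier assign $\boldsymbol{x}$ to class $+$ if $\boldsymbol{w}\cdot\boldsymbol{x}+b>0$ and to class $-$ otherwise. Let $\varepsilon>0$. Put $\boldsymbol{\mu}=\frac12(\boldsymbol{\mu}_+-\boldsymbol{\mu}_-)$, $\bar{\boldsymbol{\mu}}=\frac12(\boldsymbol{\mu}_++\boldsymbol{\mu}_-)$, $b'=\boldsymbol{w}\cdot\bar{\boldsymbol{\mu}}+b$. Let $p_m$ be the probability that $\boldsymbol{X}$ is misclassified and $p_{adv}$ the probability that $\boldsymbol{X}$ is correctly classified and has an $\varepsilon$-adversarial example. Then $$p_{adv}=1-p_m-\frac12\left[\Phi\!\left(\frac{\boldsymbol{w}\cdot\boldsymbol{\mu}+b'}{\|\boldsymbol{w}\|\sigma}-\frac{\varepsilon}{\sigma}\right)+\Phi\!\left(\frac{\boldsymbol{w}\cdot\boldsymbol{\mu}-b'}{\|\boldsymbol{w}\|\sigma}-\frac{\varepsilon}{\sigma}\right)\right].$$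
   Context: $\Phi$ is the standard normal CDF and $\|\cdot\|$ the Euclidean norm. An $\varepsilon$-adversarial example of $\boldsymbol{x}$ is a point $\boldsymbol{x}'$ with $\|\boldsymbol{x}-\boldsymbol{x}'\|\le\varepsilon$ that is assigned a different class than $\boldsymbol{x}$ by the classifier. *)

(* Defs.v *)
From HB Require Import structures.
From mathcomp Require Import all_boot all_order all_algebra.
From mathcomp Require Import all_classical all_reals all_analysis.
From mathcomp Require Import normal_distribution.
Set Implicit Arguments. Unset Strict Implicit. Unset Printing Implicit Defensive.
Import Order.TTheory GRing.Theory Num.Theory.
Local Open Scope classical_set_scope.
Local Open Scope ring_scope.

Section Defs.
Context {R : realType} {d : nat}.

Definition dotv (u v : 'rV[R]_d) : R := \sum_(j < d) u ord0 j * v ord0 j.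
Definition enorm (u : 'rV[R]_d) : R := Num.sqrt (dotv u u).

(* linear classifier: true = class +, false = class - *)
Definition classify (w : 'rV[R]_d) (b : R) (x : 'rV[R]_d) : bool :=
  0 < dotv w x + b.

Definition has_adv (w : 'rV[R]_d) (b eps : R) (x : 'rV[R]_d) : Prop :=
  exists x' : 'rV[R]_d, enorm (x - x') <= eps /\ classify w b x' != classify w b x.
End Defs.

Definition Phi {R : realType} (x : R) : R :=
  fine (normal_prob 0 1 `]-oo, x]).

(* (X, Y) is the balanced Gaussian mixture: P(Y = +) = P(Y = -) = 1/2 and,
   conditionally on Y = i, X ~ N(mu_i, sigma^2 I_d), i.e. the joint law of
   (Y, X) on rectangles is  P(Y = i, X in B_0 x ... x B_{d-1}) =
   P(Y = i) * prod_j N(mu_i j, sigma^2)(B_j).  Y = true encodes class +. *)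
Definition gaussian_mixture {R : realType} {d : nat}
  (dT : measure_display) (T : measurableType dT) (P : probability T R)
  (X : T -> 'rV[R]_d) (Y : T -> bool) (mup mum : 'rV[R]_d) (sigma : R) : Prop :=
  [/\ (forall j, measurable_fun setT (fun t => X t ord0 j)),
      measurable (Y @^-1` [set true]),
      P [set t | Y t] = (2^-1)%:E,
      P [set t | ~~ Y t] = (2^-1)%:E &
      forall (i : bool) (B : 'I_d -> set R), (forall j, measurable (B j)) ->
        P [set t | Y t = i /\ forall j, B j (X t ord0 j)] =
        ((2^-1)%:E * \prod_(j < d)
           normal_prob ((if i then mup else mum) ord0 j) sigma (B j))%E ].

(* Main.v *)
Require Import Defs.
From HB Require Import structures.
From mathcomp Require Import all_boot all_order all_algebra.
From mathcomp Require Import all_classical all_reals all_analysis.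
From mathcomp Require Import measurable_realfun normal_distribution.
From mathcomp Require Import ring lra.
Import Order.TTheory GRing.Theory Num.Theory.
Local Open Scope classical_set_scope.
Local Open Scope ring_scope.

(** Conditionally on the label, [w.X] is a linear combination of independent
    normal coordinates, hence normal with mean [w.mu_i] and standard deviation
    [|w| sigma].  By Cauchy-Schwarz, with equality along [w], a point has an
    adversarial example iff its score [w.x + b] can be pushed across 0 by a
    change of [eps |w|].  The complement of "misclassified, or correctly
    classified with an adversarial example" is therefore the disjoint union of
    [Y = +, w.X + b > eps |w|] and [Y = -, w.X + b <= - eps |w|], and each of
    these tails is half a value of [Phi]. *)

(** * Affine changes of variable for Lebesgue measure and normal laws *)

Section affine.
Context {R : realType}.
Local Notation mu := (@lebesgue_measure R).
Implicit Types (a c m s : R) (A : set (measurableTypeR R)).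

Lemma measurable_affine a c : measurable_fun setT
  ((fun x => a * x + c) : measurableTypeR R -> measurableTypeR R).
Proof. by apply: measurable_funD => //; apply: measurable_funM. Qed.

Lemma measurable_preimage_comb a A : measurable A ->
  measurable [set z : measurableTypeR R * measurableTypeR R |
    A (a * z.1 + z.2)].
Proof.
move=> mA; rewrite -[X in measurable X]setTI.
have mf : measurable_fun setT ((fun z => a * z.1 + z.2) :
    measurableTypeR R * measurableTypeR R -> measurableTypeR R).
  by apply: measurable_funD => //; apply: measurable_funM.
exact: mf.
Qed.

(** The push-forward of Lebesgue measure, scaled by [|a|], gives every half-open interval its
    length, so uniqueness of Lebesgue measure applies. *)
Lemma lebesgue_measure_affine a c A : a != 0 -> measurable A ->
  (`|a|%:E * mu [set x | A (a * x + c)%R] = mu A)%E.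
Proof.
move=> a0 mA.
pose na : {nonneg R} := NngNum (normr_ge0 a).
have mc := measurable_affine a c.
pose nu := (mscale na
  (pushforward mu ((fun x => a * x + c) : _ -> measurableTypeR R)) :
  {measure set _ -> \bar R}).
rewrite [RHS](@lebesgue_measure_unique R (nu mc))//.
move=> _ [[u v]] _ <-.
rewrite /nu/= /mscale/= /pushforward.
have [ap|an|a00] := ltgtP a 0; last by rewrite a00 eqxx in a0.
(* For [a < 0] the map reverses order, so the preimage of []u, v]] is closed on the left and open on
   the right. *)
- rewrite (_ : _ @^-1` _ = `[(v - c) / a, (u - c) / a[%classic); last first.
    apply/seteqP; split => x /=; rewrite !in_itv/=.
      by move=> /andP[ux xv]; rewrite ler_ndivrMr// ltr_ndivlMr//; lra.
    by rewrite ler_ndivrMr// ltr_ndivlMr// => /andP[ux xv]; apply/andP; split; lra.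
  rewrite !lebesgue_measure_itv/= !lte_fin ltr_nM2r ?invr_lt0// ltrBlDr subrK.
  case: ifPn => // uv; last by rewrite mule0.
  by rewrite -EFinM; congr EFin; rewrite ltr0_norm//; field.
- rewrite (_ : _ @^-1` _ = `](u - c) / a, (v - c) / a]%classic); last first.
    apply/seteqP; split => x /=; rewrite !in_itv/=.
      by move=> /andP[ux xv]; rewrite ltr_pdivrMr// ler_pdivlMr//; lra.
    by rewrite ltr_pdivrMr// ler_pdivlMr// => /andP[ux xv]; apply/andP; split; lra.
  rewrite !lebesgue_measure_itv/= !lte_fin ltr_pM2r ?invr_gt0// ltrBlDr subrK.
  case: ifPn => // uv; last by rewrite mule0.
  by rewrite -EFinM; congr EFin; rewrite gtr0_norm//; field.
Qed.

(** The Jacobian [|a|] cancels the scaling of the peak, and [a] and [c] drop out of the standardised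
    square in the exponent. *)
Lemma normal_pdf_affine m s a c x : a != 0 -> s != 0 ->
  `|a| * normal_pdf (a * m + c) (`|a| * s) (a * x + c) = normal_pdf m s x.
Proof.
move=> a0 s0; rewrite !normal_pdfE ?mulf_neq0 ?normr_eq0//.
rewrite mulrA; congr (_ * _).
  rewrite /normal_peak exprMn -mulrA -mulrnAr sqrtrM ?exprn_ge0//.
  by rewrite sqrtr_sqr normr_id invfM mulrA divff ?mul1r ?normr_eq0.
by rewrite /normal_fun exprMn -normrX ger0_norm ?sqr_ge0//; congr expR; field; apply/andP.
Qed.

Lemma normal_prob_affine m s a c A : a != 0 -> s != 0 -> measurable A ->
  normal_prob m s [set x | A (a * x + c)%R] = normal_prob (a * m + c) (`|a| * s) A.
Proof.
move=> a0 s0 mA; rewrite /normal_prob.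
pose na : {nonneg R} := NngNum (normr_ge0 a).
have mc := measurable_affine a c.
pose nu := (mscale na
  (pushforward mu ((fun x => a * x + c) : _ -> measurableTypeR R)) :
  {measure set _ -> \bar R}).
have mpdf m' s' D : measurable_fun D (fun x : measurableTypeR R => (normal_pdf m' s' x)%:E).
  by apply/measurable_EFinP; apply: measurable_funTS; exact: measurable_normal_pdf.
(* Lebesgue measure is replaced by the scaled push-forward [nu mc], so that the integral can be
   pulled back along [a * x + c]. *)
transitivity (\int[nu mc]_(x in A) (normal_pdf (a * m + c) (`|a| * s) x)%:E)%E; last first.
  by apply: eq_measure_integral => B mB _; exact: lebesgue_measure_affine.
rewrite ge0_integral_mscale//; last by move=> x _; rewrite lee_fin normal_pdf_ge0.
rewrite ge0_integral_pushforward//; last by move=> x _; rewrite lee_fin normal_pdf_ge0.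
rewrite -ge0_integralZl//=.
- by apply: eq_integral => x _; rewrite /= -EFinM normal_pdf_affine.
- by rewrite -[X in measurable X]setTI; exact: mc.
- by apply: measurableT_comp => //; apply: measurable_funTS.
- by move=> x _; rewrite lee_fin normal_pdf_ge0.
Qed.

(** The Radon-Nikodym derivative of the normal law equals [normal_pdf] almost everywhere, since both
    have the same integral over every measurable set. *)
Lemma integral_normal_prob m s f : measurable_fun setT f ->
  (\int[normal_prob m s]_x `|f x| < +oo)%E ->
  (\int[normal_prob m s]_x f x = \int[mu]_x (f x * (normal_pdf m s x)%:E))%E.
Proof.
move=> mf finf.
rewrite -(Radon_Nikodym_change_of_variables (normal_prob_dominates m s))//=; last first.
  by apply/integrableP; split.
have mpdf : measurable_fun setT (fun x : measurableTypeR R => (normal_pdf m s x)%:E).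
  by apply/measurable_EFinP; exact: measurable_normal_pdf.
apply: ae_eq_integral => //.
- apply: emeasurable_funM => //; apply: measurable_int.
  by apply: Radon_Nikodym_integrable; exact: normal_prob_dominates.
- exact: emeasurable_funM.
- apply: ae_eqe_mul2l; apply: integral_ae_eq => //.
  + by apply: Radon_Nikodym_integrable; exact: normal_prob_dominates.
  + by move=> E _ mE; rewrite -Radon_Nikodym_integral//; exact: normal_prob_dominates.
Qed.

End affine.

(** * Convolution of two normal laws *)

Section conv.
Context {R : realType}.
Local Notation mu := (@lebesgue_measure R).
Implicit Types (a c m s x y : R) (A : set (measurableTypeR R)).

(* Completing the square: as a function of [x] the right-hand side is a constant
   times a normal density, which therefore integrates out. *)
Lemma normal_pdf_conv m1 s1 m2 s2 a x y : 0 < s1 -> 0 < s2 ->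
  let v := (a * s1) ^+ 2 + s2 ^+ 2 in
  normal_pdf m1 s1 x * normal_pdf (a * x + m2) s2 y =
  normal_pdf (a * m1 + m2) (Num.sqrt v) y *
  normal_pdf (m1 + a * s1 ^+ 2 * (y - (a * m1 + m2)) / v) (s1 * s2 / Num.sqrt v) x.
Proof.
move=> s10 s20 v.
have v0 : 0 < v by rewrite ltr_wpDl ?sqr_ge0// exprn_gt0.
have sv0 : 0 < Num.sqrt v by rewrite sqrtr_gt0.
rewrite !normal_pdfE ?gt_eqF ?divr_gt0 ?mulr_gt0//.
rewrite mulrACA [RHS]mulrACA; congr (_ * _).
  rewrite /normal_peak -!invfM; congr (_^-1).
  rewrite -!sqrtrM; last 2 first.
    by rewrite mulrn_wge0// mulr_ge0 ?sqr_ge0 ?pi_ge0.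
    by rewrite mulrn_wge0// mulr_ge0 ?sqr_ge0 ?pi_ge0.
  congr Num.sqrt; rewrite !exprMn exprVn sqr_sqrtr ?ltW//.
  by field; rewrite gt_eqF.
rewrite /normal_fun -!expRD; congr expR.
rewrite !exprMn exprVn sqr_sqrtr ?ltW//.
rewrite /v in v0 *; field.
by rewrite !gt_eqF.
Qed.

Lemma measurable_normal_pdf_joint m s a : s != 0 ->
  measurable_fun setT (fun z : measurableTypeR R * measurableTypeR R =>
    normal_pdf (a * z.1 + m) s z.2 : R).
Proof.
(* Moving the mean into the argument leaves one fixed centred density composed with a measurable map
   of the pair. *)
move=> s0; rewrite (_ : (fun _ => _) = normal_pdf 0 s \o (fun z => z.2 - (a * z.1 + m))).
  apply: measurableT_comp; first exact: measurable_normal_pdf.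
  apply: measurable_funB => //; apply: measurable_funD => //.
  by apply: measurable_funM.
apply/funext => z /=; rewrite !normal_pdfE//.
by congr (_ * _); rewrite [in LHS]normal_fun_center.
Qed.

(** Both factors are written with densities and Tonelli makes [x] the inner variable. By
    [normal_pdf_conv], [x] then occurs only in a density of total mass 1, which leaves the claimed
    density in [y]. *)
Lemma normal_prob_conv m1 s1 m2 s2 a A : 0 < s1 -> 0 < s2 -> measurable A ->
  ((normal_prob m1 s1 \x normal_prob m2 s2) [set z | A (a * z.1 + z.2)%R] =
   normal_prob (a * m1 + m2)%R (Num.sqrt ((a * s1) ^+ 2 + s2 ^+ 2))%R A)%E.
Proof.
move=> s10 s20 mA; rewrite /product_measure1.
have s2n : s2 != 0 by rewrite gt_eqF.
have mB := measurable_preimage_comb a A mA.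
have mm1 : measurable_fun [set: R] (normal_prob m2 s2 \o
    xsection [set z : measurableTypeR R * measurableTypeR R |
      A (a * z.1 + z.2)%R]).
  exact: measurable_fun_xsection.
rewrite integral_normal_prob//; last first.
  apply: (@le_lt_trans _ _ (\int[normal_prob m1 s1]_x cst 1 x)%E).
    apply: ge0_le_integral => //.
      by apply: measurableT_comp.
    by move=> x _ /=; rewrite gee0_abs// probability_le1//; exact: measurable_xsection.
  by rewrite integral_cst// mul1e (le_lt_trans (probability_le1 _ _))// ltry.
pose f (z : measurableTypeR R * measurableTypeR R) : \bar R :=
  (normal_pdf m1 s1 z.1 * (normal_pdf (a * z.1 + m2) s2 z.2 * \1_A z.2))%:E.
have mf : measurable_fun setT f.
  apply/measurable_EFinP; apply: measurable_funM.
    by apply: measurableT_comp => //; exact: measurable_normal_pdf.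
  apply: measurable_funM; first exact: measurable_normal_pdf_joint.
  by apply: measurableT_comp => //; exact: measurable_indic.
have f0 z : (0 <= f z)%E.
  by rewrite lee_fin !mulr_ge0 ?normal_pdf_ge0.
transitivity (\int[mu]_x \int[mu]_y f (x, y))%E.
  apply: eq_integral => x _ /=.
  (* The section at [x] is a translate of [A]; the slope 1 is written out to match
     [normal_prob_affine], which shifts the mean to [a * x + m2]. *)
  rewrite (_ : xsection _ _ = [set y | A (1 * y + a * x)]); last first.
    by apply/seteqP; split => y; rewrite /xsection/= inE/= mul1r addrC.
  rewrite (@normal_prob_affine _ m2 s2 1 (a * x) A)// mul1r normr1 mul1r addrC.
  rewrite /normal_prob muleC -ge0_integralZl//=; last 3 first.
  - by apply/measurable_EFinP; apply: measurable_funTS; exact: measurable_normal_pdf.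
  - by move=> y _; rewrite lee_fin normal_pdf_ge0.
  - by rewrite lee_fin normal_pdf_ge0.
  rewrite integral_mkcond; apply: eq_integral => y _ /=.
  by rewrite /f patchE indicE/=; case: ifP => _; rewrite ?mulr1// !mulr0.
rewrite fubini_tonelli// /normal_prob [RHS]integral_mkcond; apply: eq_integral => y _ /=.
rewrite patchE /f/= indicE.
case: ifP => yA; last by apply: integral0_eq => x _; rewrite !mulr0.
under eq_integral do rewrite /= mulr1 normal_pdf_conv// EFinM.
rewrite ge0_integralZl//=.
- by rewrite integral_normal_pdf mule1.
- by apply/measurable_EFinP; exact: measurable_normal_pdf.
- by move=> x _; rewrite lee_fin normal_pdf_ge0.
- by rewrite lee_fin normal_pdf_ge0.
Qed.
End conv.

(** * Linear combinations of independent normal variables *)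

Section combination.
Context {R : realType} {dT : measure_display} {T : measurableType dT}.
Variable Q : {measure set T -> \bar R}.

(** On [E], the joint law of [(U, V)] agrees with [c] times a product measure on rectangles, hence
    everywhere. The event [E] and the factor [c] let an induction carry along the coordinates not
    yet summed. *)
Lemma normal_combination2 (U V : T -> measurableTypeR R) (E : set T)
    (m1 s1 m2 s2 a : R) (c : \bar R) :
  (0 <= c)%E -> c \is a fin_num ->
  measurable_fun setT U -> measurable_fun setT V -> measurable E ->
  0 < s1 -> 0 < s2 ->
  (forall A B, measurable A -> measurable B ->
    Q ((U @^-1` A `&` V @^-1` B) `&` E) =
    c * (normal_prob m1 s1 A * normal_prob m2 s2 B))%E ->
  forall A : set (measurableTypeR R), measurable A ->
    Q ([set t | A (a * U t + V t)] `&` E) =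
    (c *
      normal_prob (a * m1 + m2)%R (Num.sqrt ((a * s1) ^+ 2 + s2 ^+ 2)) A)%E.
Proof.
move=> c0 cfin mU mV mE s10 s20 indep A mA.
have mUV : measurable_fun setT (fun t => (U t, V t)) by exact: measurable_fun_pair.
pose C := [set z : measurableTypeR R * measurableTypeR R | A (a * z.1 + z.2)].
have mC : measurable C by exact: measurable_preimage_comb.
pose nu := (pushforward (mrestr Q mE) (fun t => (U t, V t)) : {measure set _ -> \bar R}).
rewrite -(normal_prob_conv m1 s1 m2 s2 a A s10 s20 mA).
(* The constant is absorbed into the first factor, which makes the target a genuine product
   measure. *)
transitivity ((mscale (NngNum (fine_ge0 c0)) (normal_prob m1 s1) \x normal_prob m2 s2)%E C); last first.
  rewrite /product_measure1 ge0_integral_mscale//= ?fineK//.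
  exact: measurable_fun_xsection.
symmetry; apply: (@product_measure_unique _ _ _ _ _ _ _ (nu mUV)) => // B D mB mD.
by rewrite /nu/= /pushforward/mrestr/= /mscale/= fineK// -muleA -indep.
Qed.

Variables (c : \bar R) (n : nat) (X : 'I_n -> T -> measurableTypeR R) (m s : 'I_n -> R).
Hypotheses (c_ge0 : (0 <= c)%E) (c_fin : c \is a fin_num).
Hypothesis mX : forall j, measurable_fun setT (X j).
Hypothesis s_gt0 : forall j, 0 < s j.
Hypothesis indep : forall B : 'I_n -> set (measurableTypeR R),
  (forall j, measurable (B j)) ->
  Q [set t | forall j, B j (X j t)] =
  (c * \prod_(j < n) normal_prob (m j) (s j) (B j))%E.

(* [w j0 != 0] with [j0] the innermost summand keeps the variance of every
   partial sum positive: [normal_prob _ 0] is not a Dirac mass but the uniform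
   law on [0, 1]. *)
Lemma normal_combination_seq (w : 'I_n -> R) (j0 : 'I_n) (r : seq 'I_n)
    (A : set (measurableTypeR R)) (B : 'I_n -> set (measurableTypeR R)) :
  w j0 != 0 -> uniq (rcons r j0) -> measurable A ->
  (forall j, measurable (B j)) ->
  Q ([set t | A (\sum_(j <- rcons r j0) w j * X j t)] `&`
     [set t | forall j, j \notin rcons r j0 -> B j (X j t)]) =
  (c *
    (normal_prob (\sum_(j <- rcons r j0) w j * m j)%R
       (Num.sqrt (\sum_(j <- rcons r j0) (w j * s j) ^+ 2)%R) A *
     \prod_(j | j \notin rcons r j0) normal_prob (m j) (s j) (B j)))%E.
Proof.
move=> w0; elim: r A B => [|j r IH] A B /=.
  move=> _ mA mB.
  rewrite !big_seq1 sqrtr_sqr normrM (gtr0_norm (s_gt0 j0)).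
  have mA' : measurable [set x : measurableTypeR R | A (w j0 * x + 0)].
    by rewrite -[X in measurable X]setTI; exact: measurable_affine.
  (* The condition on the single summand becomes side [j0] of a box, to which [indep] applies
     directly. *)
  pose B' (j : 'I_n) : set (measurableTypeR R) :=
    if j == j0 then [set x | A (w j0 * x + 0)] else B j.
  have mB' j : measurable (B' j) by rewrite /B'; case: ifP => _.
  rewrite (_ : _ `&` _ = [set t | forall j, B' j (X j t)]); last first.
    apply/seteqP; split => t /=.
      move=> [At Bt] j; rewrite /B'; have [->/=|jj0] := eqVneq j j0.
        by rewrite addr0; rewrite big_seq1 in At.
      by apply: Bt; rewrite inE.
    move=> H; split; first by have := H j0; rewrite /B' eqxx big_seq1/= addr0.
    by move=> j; rewrite inE => jj0; have := H j; rewrite /B' (negPf jj0).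
  rewrite (indep _ mB') [in LHS](bigD1 j0)//= {1}/B' eqxx.
  rewrite (@normal_prob_affine _ (m j0) (s j0) (w j0) 0 A) ?(gt_eqF (s_gt0 j0))// addr0.
  congr (_ * (_ * _))%E; apply: eq_big => [j|j /negPf jj0]; first by rewrite inE.
  by rewrite /B' jj0.
move=> /andP[jr ur] mA mB.
set r' := rcons r j0.
have v0 : 0 < \sum_(j <- r') (w j * s j) ^+ 2.
  rewrite /r' -cats1 big_cat/= big_seq1 ltr_wpDl ?sumr_ge0//.
    by move=> i _; rewrite sqr_ge0.
  by rewrite exprn_even_gt0//= mulf_neq0// gt_eqF.
(* Constraints on the coordinates outside the enlarged sum; their probabilities join [c] as the
   constant of [normal_combination2]. *)
set E := [set t | forall i, i \notin j :: r' -> B i (X i t)].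
have mE : measurable E.
  rewrite (_ : E = \big[setI/setT]_(i <- index_enum 'I_n | i \notin j :: r')
      (X i @^-1` B i)).
    by apply: bigsetI_measurable => i _; rewrite -[X in measurable X]setTI; exact: mX.
  apply/seteqP; split => t; rewrite -bigcap_seq_cond /=.
    by move=> Et i /= /andP[_ ir]; exact: Et.
  by move=> Et i ir; apply: Et => /=; rewrite mem_index_enum.
have mS : measurable_fun setT ((fun t => \sum_(i <- r') w i * X i t) :
    T -> measurableTypeR R).
  apply: measurable_sum => i.
  by apply: measurable_funM; [exact: measurable_cst|exact: mX].
rewrite (_ : [set t | A _] = [set t | A (w j * X j t + \sum_(i <- r') w i * X i t)]); last first.
  by apply/seteqP; split => t /=; rewrite big_cons.
have jE : j \notin r' by [].
rewrite (@normal_combination2 (X j) _ E (m j) (s j) (\sum_(i <- r') w i * m i)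
  (Num.sqrt (\sum_(i <- r') (w i * s i) ^+ 2)) (w j)
  (c * \prod_(i | i \notin j :: r') normal_prob (m i) (s i) (B i))%E)//.
- rewrite !big_cons sqr_sqrtr ?ltW//.
  by rewrite -muleA [in RHS](muleC (normal_prob _ _ _)).
- by rewrite mule_ge0// prode_ge0// => i _; exact: measure_ge0.
- by rewrite fin_numM// prode_fin_num// => i _; exact: fin_num_measure.
- by rewrite sqrtr_gt0.
move=> A1 A2 mA1 mA2.
(* Since [j] is not in [r'], the induction hypothesis leaves side [j] of the box free, and it
   receives the condition [A1] on [X j]. *)
pose B' (i : 'I_n) : set (measurableTypeR R) := if i == j then A1 else B i.
have mB' i : measurable (B' i) by rewrite /B'; case: ifP.
transitivity (Q ([set t | A2 (\sum_(i <- r') w i * X i t)] `&`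
     [set t | forall i, i \notin r' -> B' i (X i t)])).
  congr (Q _); apply/seteqP; split => t /=.
    move=> [[A1t A2t] Et]; split => // i ir.
    rewrite /B'; case: eqVneq => [->//|ij]; apply: Et.
    by rewrite inE negb_or ij.
  move=> [A2t Et]; split; first split => //.
    by have := Et j jE; rewrite /B' eqxx.
  move=> i; rewrite inE negb_or => /andP[ij ir].
  by have := Et i ir; rewrite /B' (negPf ij).
rewrite IH// (bigD1 j)//= {1}/B' eqxx.
rewrite -!muleA; congr (_ * _)%E.
rewrite [RHS]muleC -muleA muleCA; congr (_ * (_ * _))%E.
apply: eq_big => [i|i]; first by rewrite inE negb_or andbC.
by rewrite /B' => /andP[_ /negPf ->].
Qed.

Lemma normal_combination (w : 'I_n -> R) (A : set (measurableTypeR R)) :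
  (exists j, w j != 0) -> measurable A ->
  Q [set t | A (\sum_(j < n) w j * X j t)] =
  (c * normal_prob (\sum_(j < n) w j * m j)%R
         (Num.sqrt (\sum_(j < n) (w j * s j) ^+ 2)%R) A)%E.
Proof.
move=> [j0 w0] mA.
(* All indices are enumerated with [j0] last, so no coordinate remains outside the sum and the
   residual product is empty. *)
pose r := rcons [seq j <- index_enum 'I_n | j != j0] j0.
have ur : uniq r.
  by rewrite rcons_uniq mem_filter eqxx/= filter_uniq// index_enum_uniq.
have mr j : j \in r.
  by rewrite mem_rcons inE mem_filter mem_index_enum andbT; case: eqVneq.
have pr : perm_eq (index_enum 'I_n) r.
  by apply: uniq_perm => // [|j]; rewrite ?index_enum_uniq// mem_index_enum mr.
have := @normal_combination_seq w j0 _ A (fun=> setT) w0 ur mA (fun=> measurableT).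
rewrite -/r -!(perm_big _ pr)/= [X in (normal_prob _ _ A * X)%E]big_pred0; last first.
  by move=> j; rewrite mr.
rewrite mule1 => <-; congr (Q _); apply/seteqP; split => t /=.
  by rewrite (perm_big _ pr).
by rewrite (perm_big _ pr) => -[].
Qed.
End combination.

(** * Normal tails in terms of [Phi] *)

Section standard_normal.
Context {R : realType}.
Implicit Types m s x : R.

Lemma normal_prob_Nyc m s x : 0 < s ->
  normal_prob m s `]-oo, x] = (Phi ((x - m) / s))%:E.
Proof.
move=> s0; rewrite /Phi fineK; last exact: fin_num_measure.
have := @normal_prob_affine R 0 1 s m _ (lt0r_neq0 s0) (oner_neq0 R)
  (measurable_itv `]-oo, x]).
rewrite mulr0 add0r mulr1 (gtr0_norm s0) => <-.
congr (normal_prob _ _ _); apply/seteqP; split => y /=; rewrite !in_itv/=.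
  by rewrite ler_pdivlMr// => ?; lra.
by rewrite ler_pdivlMr// => ?; lra.
Qed.

Lemma normal_prob_oy m s x : 0 < s ->
  normal_prob m s `]x, +oo[ = (Phi ((m - x) / s))%:E.
Proof.
move=> s0.
pose z := (m - x) / s.
(* The reflection with slope [- s] sends an open upper tail to an open lower one, whereas [Phi] uses
   the closed half-line; the endpoint carries no mass. *)
have -> : (Phi z)%:E = normal_prob 0 1 `]-oo, z[.
  rewrite /Phi fineK; last exact: fin_num_measure.
  rewrite /normal_prob; symmetry.
  apply: integral_itv_bndo_bndc; apply/measurable_EFinP/measurable_funTS.
  exact: measurable_normal_pdf.
have Ns0 : - s != 0 by rewrite oppr_eq0 gt_eqF.
have := @normal_prob_affine R 0 1 (- s) m _ Ns0 (oner_neq0 R)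
  (measurable_itv `]x, +oo[).
rewrite mulr0 add0r mulr1 normrN (gtr0_norm s0) => <-.
congr (normal_prob _ _ _); apply/seteqP; split => y /=; rewrite !in_itv/= andbT.
  by rewrite ltr_pdivlMr// => ?; lra.
by rewrite ltr_pdivlMr// => ?; lra.
Qed.
End standard_normal.

(** * Euclidean geometry and adversarial examples of a linear classifier *)

Section linear_classifier.
Context {R : realType} {d : nat}.
Implicit Types (u v w x : 'rV[R]_d) (b eps : R).

Lemma dotvDr u v w : dotv u (v + w) = dotv u v + dotv u w.
Proof.
rewrite /dotv -big_split; apply: eq_bigr => j _.
by rewrite mxE mulrDr.
Qed.

Lemma dotvZr a u v : dotv u (a *: v) = a * dotv u v.
Proof.
rewrite /dotv mulr_sumr; apply: eq_bigr => j _.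
by rewrite mxE mulrCA.
Qed.

Lemma dotvBr u v w : dotv u (v - w) = dotv u v - dotv u w.
Proof. by rewrite -scaleN1r dotvDr dotvZr mulN1r. Qed.

Lemma dotvC u v : dotv u v = dotv v u.
Proof. by apply: eq_bigr => j _; rewrite mulrC. Qed.

Lemma dotv_ge0 u : 0 <= dotv u u.
Proof. by apply: sumr_ge0 => j _; rewrite -expr2 sqr_ge0. Qed.

Lemma enorm_sqr u : enorm u ^+ 2 = dotv u u.
Proof. by rewrite sqr_sqrtr ?dotv_ge0. Qed.

Lemma enorm_gt0 u : u != 0 -> 0 < enorm u.
Proof.
move=> u0; rewrite sqrtr_gt0 lt_neqAle dotv_ge0 andbT eq_sym.
apply: contra u0; rewrite psumr_eq0 => [/allP u0|j _]; last by rewrite -expr2 sqr_ge0.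
apply/eqP/rowP => j; rewrite mxE.
by have := u0 j (mem_index_enum j); rewrite /= mulf_eq0 orbb => /eqP.
Qed.

Lemma enormZ a u : enorm (a *: u) = `|a| * enorm u.
Proof.
rewrite /enorm dotvZr dotvC dotvZr mulrA -expr2 sqrtrM ?sqr_ge0//.
by rewrite sqrtr_sqr.
Qed.

Lemma enormN u : enorm (- u) = enorm u.
Proof. by rewrite -scaleN1r enormZ normrN1 mul1r. Qed.

(** With [p] and [q] the norms of [u] and [v], the squared norm of [q *: u - p *: v] is
    [2 * p * q * (p * q - dotv u v)]. Zero vectors are treated first so that [p * q] can be
    cancelled. *)
Lemma dotv_le_enorm u v : dotv u v <= enorm u * enorm v.
Proof.
have [->|u0] := eqVneq u 0.
  by rewrite -(scale0r 0) dotvC dotvZr enormZ normr0 !mul0r.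
have [->|v0] := eqVneq v 0.
  by rewrite -(scale0r 0) dotvZr enormZ normr0 !mul0r mulr0.
have := dotv_ge0 (enorm v *: u - enorm u *: v).
rewrite dotvBr !dotvZr ![dotv (_ - _) _]dotvC !dotvBr !dotvZr.
rewrite -!enorm_sqr [dotv v u]dotvC.
have p0 := enorm_gt0 _ u0; have q0 := enorm_gt0 _ v0.
set p := enorm u in p0 *; set q := enorm v in q0 *.
rewrite (_ : _ - _ = (p * q) * (2 * (p * q - dotv u v))); last by ring.
by rewrite pmulr_rge0 ?mulr_gt0// pmulr_rge0// subr_ge0.
Qed.

(** Cauchy-Schwarz bounds the change of score, and a move along [w] attains the bound. A score of
    exactly 0 belongs to class [-]: reaching 0 suffices to leave class [+], but 0 must be exceeded
    to leave class [-], hence one weak and one strict inequality. *)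
Lemma has_advP w b eps x : w != 0 -> 0 < eps ->
  has_adv w b eps x <->
  (if classify w b x then dotv w x + b <= eps * enorm w
   else - (eps * enorm w) < dotv w x + b).
Proof.
move=> w0 eps0; have p0 := enorm_gt0 _ w0.
split.
  move=> [x' [xx' ]].
  have h1 : dotv w (x - x') <= enorm w * eps.
    by rewrite (le_trans (dotv_le_enorm _ _))// ler_wpM2l// ltW.
  have h2 : dotv w (x' - x) <= enorm w * eps.
    rewrite (le_trans (dotv_le_enorm _ _))// ler_wpM2l//; first exact: ltW.
    by rewrite -opprB enormN.
  move: h1 h2; rewrite !dotvBr /classify.
  case: ifPn => cx h1 h2; first by rewrite eqb_id -leNgt; lra.
  by rewrite eqbF_neg negbK => ?; lra.
(* The vector [t *: w] has norm [eps] and changes the score by [eps * enorm w]. *)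
pose t := eps / enorm w.
have tE : t * dotv w w = eps * enorm w.
  by rewrite -enorm_sqr /t; field; rewrite gt_eqF.
have tN : `|t| * enorm w = eps.
  by rewrite gtr0_norm ?divr_gt0// divfK// gt_eqF.
rewrite /classify; case: ifPn => cx h.
  exists (x - t *: w); split.
    by rewrite opprB addrCA subrr addr0 enormZ tN.
  by rewrite /classify dotvBr dotvZr tE cx eqb_id -leNgt; lra.
exists (x + t *: w); split.
  by rewrite opprD addrA subrr sub0r enormN enormZ tN.
by rewrite /classify dotvDr dotvZr tE (negbTE cx) eqbF_neg negbK; lra.
Qed.
End linear_classifier.

(** * The law of the score on each label event *)

Section gaussian_mixture_law.
Context {R : realType} {d : nat} {dT : measure_display} {T : measurableType dT}.
Variables (P : probability T R) (X : T -> 'rV[R]_d) (Y : T -> bool).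
Variables (mup mum : 'rV[R]_d) (sigma : R).
Hypothesis sigma_gt0 : 0 < sigma.
Hypothesis mix : gaussian_mixture P X Y mup mum sigma.

Lemma gaussian_mixture_measurable_dotv (w : 'rV[R]_d) :
  measurable_fun setT ((fun t => dotv w (X t)) : T -> measurableTypeR R).
Proof.
case: mix => mX _ _ _ _; apply: measurable_sum => j.
by apply: measurable_funM; [exact: measurable_cst|exact: mX].
Qed.

Lemma gaussian_mixture_measurable_label (i : bool) : measurable (Y @^-1` [set i]).
Proof.
case: mix => _ mY _ _ _; case: i => //.
rewrite (_ : _ @^-1` _ = ~` (Y @^-1` [set true])); first exact: measurableC.
by apply/seteqP; split => t /=; case: (Y t).
Qed.

Lemma gaussian_mixture_dotv (w : 'rV[R]_d) (i : bool) (A : set (measurableTypeR R)) :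
  w != 0 -> measurable A ->
  P [set t | Y t = i /\ A (dotv w (X t))] =
  ((2^-1)%:E * normal_prob (dotv w (if i then mup else mum)) (enorm w * sigma) A)%E.
Proof.
move=> w0 mA; have mY := gaussian_mixture_measurable_label i.
case: mix => mX _ _ _ PE; set mu := if i then mup else mum.
have w_neq0 : exists j, w ord0 j != 0.
  by apply/existsP; apply: contra_neqT w0 => /existsPn w0; apply/rowP => j;
     rewrite mxE; apply/eqP/negPn/w0.
have -> : enorm w * sigma = Num.sqrt (\sum_(j < d) (w ord0 j * sigma) ^+ 2).
  rewrite -[X in _ * X](gtr0_norm sigma_gt0) -sqrtr_sqr -sqrtrM ?dotv_ge0//.
  congr Num.sqrt; rewrite mulr_suml; apply: eq_bigr => j _.
  by rewrite exprMn -expr2.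
(* Restricting [P] to the label event, instead of conditioning on it, gives the product form with
   constant 1/2. *)
have := @normal_combination R dT T (mrestr P mY) (2^-1)%:E d
  (fun j t => X t ord0 j) (fun j => mu ord0 j) (fun=> sigma).
move=> /(_ _ _ mX (fun=> sigma_gt0) _ (fun j => w ord0 j) A w_neq0 mA) => <-//.
  by congr (P _); apply/seteqP; split => t /= [].
move=> B mB; rewrite -PE//; congr (P _).
by apply/seteqP; split => t /= [].
Qed.
End gaussian_mixture_law.

(** * The probability of adversarial examples *)

Theorem theorem1 (R : realType) (d : nat) (dT : measure_display)
  (T : measurableType dT) (P : probability T R)
  (X : T -> 'rV[R]_d) (Y : T -> bool) (mup mum : 'rV[R]_d) (sigma : R)
  (w : 'rV[R]_d) (b eps : R) :
  0 < sigma -> w != 0 -> 0 < eps ->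
  gaussian_mixture P X Y mup mum sigma ->
  let mu := 2^-1 *: (mup - mum) in
  let mubar := 2^-1 *: (mup + mum) in
  let b' := dotv w mubar + b in
  let p_m := P [set t | classify w b (X t) != Y t] in
  let p_adv := P [set t | classify w b (X t) = Y t /\ has_adv w b eps (X t)] in
  p_adv = (1 - p_m
           - (2^-1 * (Phi ((dotv w mu + b') / (enorm w * sigma) - eps / sigma)
                      + Phi ((dotv w mu - b') / (enorm w * sigma) - eps / sigma)))%:E)%E.
Proof.
move=> sigma0 w0 eps0 mix mu mubar b' p_m p_adv.
have w_gt0 := enorm_gt0 _ w0.
have ws_gt0 : 0 < enorm w * sigma by rewrite mulr_gt0.
set e := eps * enorm w.
have e0 : 0 < e by rewrite mulr_gt0.
set s := fun t => dotv w (X t).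
(* Correct classification beyond the reach of [eps], by label. The endpoint is excluded for [+] and
   included for [-], as dictated by [has_advP]. *)
pose Ep := [set t | Y t = true /\ `]e - b, +oo[%classic (s t)].
pose Em := [set t | Y t = false /\ `]-oo, - e - b]%classic (s t)].
pose M := [set t | classify w b (X t) != Y t].
pose Adv := [set t | classify w b (X t) = Y t /\ has_adv w b eps (X t)].
have mS (A : set (measurableTypeR R)) : measurable A -> measurable (s @^-1` A).
  by move=> mA; rewrite -[X in measurable X]setTI;
     apply: (gaussian_mixture_measurable_dotv _ _ _ _ _ _ mix).
have mY i : measurable (Y @^-1` [set i]).
  exact: (gaussian_mixture_measurable_label _ _ _ _ _ _ mix).
have mEp : measurable Ep by apply: measurableI; [exact: mY|exact: mS].
have mEm : measurable Em by apply: measurableI; [exact: mY|exact: mS].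
(* Uses [dotv w mup + b = dotv w mu + b']; dividing [e] by [enorm w * sigma] leaves
   [eps / sigma]. *)
have EpE : P Ep = (2^-1 * Phi ((dotv w mu + b') / (enorm w * sigma) - eps / sigma))%:E.
  rewrite /Ep (gaussian_mixture_dotv _ _ _ _ _ _ sigma0 mix)// normal_prob_oy//.
  rewrite EFinM; congr (_ * (Phi _)%:E)%E.
  rewrite /b' /mu /mubar !(dotvBr, dotvZr, dotvDr) /e; field.
  by rewrite !gt_eqF.
(* Here [dotv w mum + b = b' - dotv w mu], which changes the sign of [b'] in the lower tail. *)
have EmE : P Em = (2^-1 * Phi ((dotv w mu - b') / (enorm w * sigma) - eps / sigma))%:E.
  rewrite /Em (gaussian_mixture_dotv _ _ _ _ _ _ sigma0 mix)// normal_prob_Nyc//.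
  rewrite EFinM; congr (_ * (Phi _)%:E)%E.
  rewrite /b' /mu /mubar !(dotvBr, dotvZr, dotvDr) /e; field.
  by rewrite !gt_eqF.
have mM : measurable M.
  rewrite (_ : M = (Y @^-1` [set true] `&` s @^-1` `]-oo, - b]) `|`
                   (Y @^-1` [set false] `&` s @^-1` `]- b, +oo[)).
    by apply: measurableU; apply: measurableI; do ?[exact: mY|exact: mS].
  apply/seteqP; split => t; rewrite /M/= /classify !in_itv/= andbT -/(s t).
    case: (Y t); first by rewrite eqb_id -leNgt => ?; left; split => //; lra.
    by rewrite eqbF_neg negbK => ?; right; split => //; lra.
  by move=> [] [-> ?]; rewrite ?eqb_id -?leNgt ?eqbF_neg ?negbK; lra.
have MAdv : M `|` Adv = ~` (Ep `|` Em).
  apply/seteqP; split => t; rewrite /M/Adv/Ep/Em/= has_advP// /classify -/(s t) -/e !in_itv/= andbT.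
    by case: (ltP 0 (s t + b)) => st; case: (Y t) => H [] [] // _ h; case: H => [|[]] // *; lra.
  case: (ltP 0 (s t + b)) => st; case: (Y t) => H; [right|left|left|right] => //; split => //.
    by rewrite leNgt; apply/negP => h; apply: H; left; split => //; lra.
  by rewrite ltNge; apply/negP => h; apply: H; right; split => //; lra.
(* [Adv] is defined by an existential over points; its measurability comes from being the difference
   of two sets already known to be measurable. *)
have mAdv : measurable Adv.
  rewrite (_ : Adv = (M `|` Adv) `\` M).
    by rewrite MAdv; apply: measurableD => //; apply: measurableC; apply: measurableU.
  apply/seteqP; split => t; rewrite /M/Adv/=; last by move=> [[]].
  by move=> [cY h]; split; [right|rewrite cY eqxx].
have : (P M + P Adv = 1 - (P Ep + P Em))%E.
  have disjM : M `&` Adv = set0 by apply/seteqP; split => t // [/eqP cY []].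
  have disjE : Ep `&` Em = set0.
    by apply/seteqP; split => t // [[Yt _] []]; rewrite Yt.
  rewrite -(measureU _ mM mAdv disjM) -(measureU _ mEp mEm disjE) MAdv.
  exact: probability_setC (measurableU _ _ mEp mEm).
rewrite EpE EmE -EFinD -mulrDr /p_m /p_adv -/M -/Adv.
(* All probabilities are finite, so the identity can be rearranged in the reals. *)
rewrite -(fineK (fin_num_measure P _ mM)) -(fineK (fin_num_measure P _ mAdv)).
by rewrite -!EFinD => -[H]; congr EFin; lra.
Qed.
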